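(* Let $\mathscr{L}$ be a space of admissible loss functions and let $K\subseteq\mathscr{L}$ be a nonempty cone, i.e. $L\in K$ and $\lambda>0$ imply $\lambda L\in K$. Let $\mathcal{O}:\mathscr{L}\to2^{\mathscr{D}}$ be an optimality operator invariant under positive scaling, i.e. $\mathcal{O}(\lambda L)=\mathcal{O}(L)$ for all $L\in\mathscr{L}$, $\lambda>0$. Let $\{\mathcal{C}_i\}_{i\in I}$ be a family of pairwise disjoint subsets of $K$ such that: (i) each $\mathcal{C}_i$ is an exclusivity region under $\mathcal{O}$ (within $\mathscr{L}$); (ii) for every $i\in I$, $\mathcal{C}_i$ contains a loss $L_i$ with $\mathcal{O}(L_i)\neq\emptyset$; (iii) for all $i\ne j$, $\mathcal{C}_i\cap\{\lambda L':\lambda>0,\ L'\in\mathcal{C}_j\}=\emptyset$. Define $\widetilde{\mathcal{C}}_i:=\{\lambda L:\lambda>0,\ L\in\mathcal{C}_i\}$ and $K':=\bigcup_{i\in I}\widetilde{\mathcal{C}}_i$. Then $\{\widetilde{\mathcal{C}}_i\}_{i\in I}$ is a realizable, total exclusivity partition of $K'$ under $\mathcal{O}$.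
   Context: A loss function is a measurable map $L:\Theta\times\mathcal{A}\to[0,\infty)$, continuous in the action $a\in\mathcal{A}$; $\mathscr{L}$ is a set of such functions, closed under multiplication by positive scalars. $\mathscr{D}$ is the set of decision rules (estimators). An optimality operator is any set-valued map $\mathcal{O}:\mathscr{L}\to2^{\mathscr{D}}$ (values may be empty). For an ambient family $\mathcal{M}\subseteq\mathscr{L}$, a subset $\mathcal{C}\subseteq\mathcal{M}$ is an exclusivity region within $\mathcal{M}$ under $\mathcal{O}$ if no $\delta\in\mathscr{D}$ belongs to $\mathcal{O}(L)$ for some $L\in\mathcal{C}$ and also to $\mathcal{O}(L')$ for some $L'\in\mathcal{M}\setminus\mathcal{C}$. A family $\{\mathcal{C}_i\}_{i\in I}$ of subsets of $\mathcal{M}$ is an exclusivity partition of $\mathcal{M}$ under $\mathcal{O}$ if the $\mathcal{C}_i$ are pairwise disjoint and each is an exclusivity region within $\mathcal{M}$; it is total if $\bigcup_i\mathcal{C}_i=\mathcal{M}$; it is realizable if for every $i$ there are $L\in\mathcal{C}_i$ and $\delta\in\mathscr{D}$ with $\delta\in\mathcal{O}(L)$. *)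

(* Defs.v *)
(* MathComp-Analysis *)
From HB Require Import structures.
From mathcomp Require Import all_boot all_order all_algebra.
From mathcomp Require Import all_classical all_reals all_analysis.

Set Implicit Arguments.
Unset Strict Implicit.
Unset Printing Implicit Defensive.

Import Order.TTheory GRing.Theory Num.Theory.
Import numFieldNormedType.Exports.
Local Open Scope classical_set_scope.
Local Open Scope ring_scope.

(* The topology and the sigma-algebra are independent: the Borel sigma-algebra
   is one possible choice. *)
#[short(type="topMeasurableType")]
HB.structure Definition TopMeasurable d := {T of Topological T & Measurable d T}.

Section LossSpace.
Context {dT dA : measure_display}.
Variables (Theta : measurableType dT) (A : topMeasurableType dA) (R : realType).

Definition loss_function : set (Theta * A -> R) :=
  [set L : Theta * A -> R | [/\ forall x, 0 <= L x,
    measurable_fun [set: Theta * A] L &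
    forall theta, continuous (fun a : A => L (theta, a))]].

Record loss_space := LossSpace {
  admissible :> set (Theta * A -> R);
  admissible_loss : admissible `<=` loss_function;
  admissible_scale : forall (l : {posnum R}) (L : Theta * A -> R),
    admissible L -> admissible (fun x => l%:num * L x) }.

End LossSpace.

Section Exclusivity.
Context {dT dA : measure_display} {Theta : measurableType dT}
  {A : topMeasurableType dA} {R : realType}.
Variable LL : loss_space Theta A R.

Definition scale (l : {posnum R}) (L : LL) : LL :=
  exist _ (fun x => l%:num * val L x)
    (mem_set (admissible_scale l (set_mem (valP L)))).

Definition is_cone (K : set LL) : Prop :=
  forall (l : {posnum R}) (L : LL), K L -> K (scale l L).

Definition positive_multiples (C : set LL) : set LL :=
  [set scale x.1 x.2 | x in [set: {posnum R}] `*` C].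

Variables (D : Type) (O : LL -> set D).

Definition scale_invariant : Prop :=
  forall (l : {posnum R}) (L : LL), O (scale l L) = O L.

Definition exclusivity_region (M C : set LL) : Prop :=
  C `<=` M /\
  ~ exists delta : D, (exists2 L, C L & O L delta) /\
                      (exists2 L', (M `\` C) L' & O L' delta).

Definition exclusivity_partition (I : Type) (M : set LL) (C : I -> set LL) :
    Prop :=
  trivIset setT C /\ forall i, exclusivity_region M (C i).

Definition total_in (I : Type) (M : set LL) (C : I -> set LL) : Prop :=
  \bigcup_i C i = M.

Definition realizable (I : Type) (C : I -> set LL) : Prop :=
  forall i, exists L, C i L /\ exists delta, O L delta.

End Exclusivity.

(* Main.v *)
Require Import Defs.
From mathcomp Require Import all_boot all_order all_algebra.
From mathcomp Require Import all_classical all_reals all_analysis.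

Set Implicit Arguments.
Unset Strict Implicit.
Unset Printing Implicit Defensive.

Local Open Scope classical_set_scope.
Import GRing.Theory.
Local Open Scope ring_scope.

(** Since [O] is constant along rays, a rule optimal for a multiple of a loss is optimal for the
    loss itself. Hence a rule shared by [Ct i] and the rest of [K'] would already be shared by [C i]
    and its complement among all losses, which (i) forbids. A loss common to [Ct i] and [Ct j]
    would, after dividing out a scalar ([scale_eq_div]), put an element of [C i] on a ray through
    [C j], against (iii). *)

Lemma scale_eq_div (R : realType) (dT dA : measure_display)
    (Theta : measurableType dT) (A : topMeasurableType dA)
    (LL : loss_space Theta A R) (l m : {posnum R}) (L L' : LL) :
  scale l L = scale m L' -> L = scale (l%:num^-1 * m%:num)%:pos L'.
Proof.
move=> /(congr1 val) /= eqLL'; apply: val_inj; apply/funext => x /=.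
have /= eqx := congr1 (@^~ x) eqLL'.
by rewrite -mulrA -eqx mulKf.
Qed.

Theorem proposition1 (R : realType) (dT dA : measure_display)
    (Theta : measurableType dT) (A : topMeasurableType dA) (D : Type)
    (LL : loss_space Theta A R) (K : set LL) (O : LL -> set D)
    (I : Type) (C : I -> set LL)
    (K_nonempty : K !=set0)
    (K_cone : is_cone K)
    (O_scale : scale_invariant O)
    (C_sub : forall i, C i `<=` K)
    (C_disjoint : trivIset setT C)
    (C_exclusive : forall i, exclusivity_region O setT (C i))
    (C_realized : forall i, exists L, C i L /\ O L !=set0)
    (C_scale_disjoint : forall i j, i <> j ->
      C i `&` positive_multiples (C j) = set0) :
  let Ct := fun i => positive_multiples (C i) in
  let K' := \bigcup_i Ct i in
  exclusivity_partition O K' Ct /\ total_in K' Ct /\ realizable O Ct.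
Proof.
move=> Ct K'; split; last split=> //.
- split=> [|i].
    move=> i j _ _ [_ [[[l L] [_ /= CiL] <-] [[m L'] [_ /= CjL'] eqLL']]].
    apply: contrapT => neq_ij.
    suff : (C i `&` positive_multiples (C j)) L.
      by rewrite C_scale_disjoint.
    split=> //; exists ((l%:num^-1 * m%:num)%:pos, L') => //=.
    by rewrite -(scale_eq_div (esym eqLL')).
  split=> [|[delta [[_ [[l L] [_ /= CiL] <-] OL]]]].
    exact: bigcup_sup.
  move=> [_ [[j _ [[m L'] [_ /= CjL'] <-]] nCtiL'] OL'].
  (* The conflict is pulled back to the unscaled losses [L] and [L']. *)
  have [_ []] := C_exclusive i; exists delta; split.
    by exists L => //; rewrite -(O_scale l).
  exists L'; last by rewrite -(O_scale m).
  (* If [L'] were in [C i], the same scalar [m] would put [scale m L'] in [Ct i]. *)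
  by split=> // CiL'; apply: nCtiL'; exists (m, L').
- move=> i; have [L [CiL [delta OL]]] := C_realized i.
  (* Scalar 1 serves as witness; [O_scale] transfers optimality, so [scale 1%:pos L] need not be
     identified with [L]. *)
  exists (scale 1%:pos L); split; first by exists (1%:pos, L).
  by exists delta; rewrite O_scale.
Qed.
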